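(* Let $X$ be a Banach space not containing $\ell_1$ with a basis $(e_i)_{i=1}^\infty$. If $I(X)\geq\omega^{\omega}$, then $I(X)=I_b(X)$, where $I(X)$ is the Bourgain $\ell_1$-index of $X$ and $I_b(X)=I_b(X,(e_i))$ is the block basis $\ell_1$-index of $X$ with respect to $(e_i)$.
   Context: Banach spaces are real; $S(X)=\{x\in X:\|x\|=1\}$; ''not containing $\ell_1$'' means having no subspace isomorphic to $\ell_1$. A tree is a countable, non-empty, partially ordered set $(T,\leq)$ such that for each $x\in T$ the set $\{y\in T:y<x\}$ is linearly ordered and finite. A tree on a set $X$ is such a set $T\subseteq\bigcup_{n\ge1}X^n$ with the extension order: $(x_1,\dots,x_m)\leq(y_1,\dots,y_n)$ iff $m\leq n$ and $x_i=y_i$ for $i\leq m$. $D(T)=\{x\in T: x<y\text{ for some }y\in T\}$; $T^0=T$, $T^{\alpha+1}=D(T^\alpha)$, and $T^\alpha=\bigcap_{\beta<\alpha}T^\beta$ for limit $\alpha$. $T$ is well-founded if it contains no infinite linearly ordered subset; for well-founded $T$, the order is $o(T)=\inf\{\alpha:T^\alpha=\emptyset\}$. An $\ell_1$-$K$-tree on $X$ is a tree $T$ on $X$ with $T\subseteq\bigcup_{n\ge1}S(X)^n$ such that for each $(x_1,\dots,x_m)\in T$ there are constants $c,C>0$ with $c^{-1}C\leq K$ and $c\sum_1^m|a_i|\leq\|\sum_1^m a_ix_i\|\leq C\sum_1^m|a_i|$ for all real $(a_i)_1^m$. An $\ell_1$-$K$-block basis tree on $X$ with respect to $(e_i)$ is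 an $\ell_1$-$K$-tree each of whose nodes $(x_1,\dots,x_n)$ is a block basis of $(e_i)$ (non-zero finite linear combinations of the $e_i$ with successive supports). For $K\geq1$, $I(X,K)=\sup\{o(T):T\text{ is an }\ell_1\text{-}K\text{-tree on }X\}$ and $I(X)=\sup_{1\leq K<\infty}I(X,K)$. Likewise $I_b(X,K)=\sup\{o(T):T\text{ is an }\ell_1\text{-}K\text{-block basis tree on }X\text{ w.r.t. }(e_i)\}$ and $I_b(X)=\sup_{1\leq K<\infty}I_b(X,K)$. *)

(* Defs.v *)
From HB Require Import structures.
From mathcomp Require Import all_boot all_order all_algebra.
From mathcomp Require Import all_classical all_reals all_analysis.

Set Implicit Arguments.
Unset Strict Implicit.
Unset Printing Implicit Defensive.

Import Order.TTheory GRing.Theory Num.Theory.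
Import numFieldNormedType.Exports.

Local Open Scope classical_set_scope.
Local Open Scope ring_scope.

(* Ordinal notations: [osup f] denotes the supremum of the ordinals denoted by
   the [f i], over an arbitrary (possibly empty, possibly uncountable) index
   type.  An ordinal has many notations, so equality of ordinals is [ord_eq],
   not Leibniz equality. *)
Inductive ord : Type :=
  | ozero
  | osucc (a : ord)
  | osup (A : Type) (f : A -> ord).

(* If P b' means "a <= b'", then [olt_of P b] means "a < b". *)
Fixpoint olt_of (P : ord -> Prop) (b : ord) : Prop :=
  match b with
  | ozero => False
  | osucc b' => P b'
  | osup _ g => exists i, olt_of P (g i)
  end.

Fixpoint ord_le (a b : ord) : Prop :=
  match a with
  | ozero => True
  | osucc a' => olt_of (ord_le a') b
  | osup _ f => forall i, ord_le (f i) b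
  end.

Definition ord_eq (a b : ord) : Prop := ord_le a b /\ ord_le b a.

Definition omax (a b : ord) : ord := osup (fun i : bool => if i then a else b).

(* In the [osup] clauses of [oadd] and [omega_pow], [omax] only matters when
   the family is empty, i.e. when [osup f] denotes 0. *)
Fixpoint oadd (a b : ord) : ord :=
  match b with
  | ozero => a
  | osucc b' => osucc (oadd a b')
  | osup _ f => omax a (osup (fun i => oadd a (f i)))
  end.

Fixpoint omul (a b : ord) : ord :=
  match b with
  | ozero => ozero
  | osucc b' => oadd (omul a b') a
  | osup _ f => osup (fun i => omul a (f i))
  end.

Definition omega : ord := osup (fun n : nat => iter n osucc ozero).

Fixpoint omega_pow (b : ord) : ord :=
  match b with
  | ozero => osucc ozero
  | osucc b' => omul (omega_pow b') omega
  | osup _ f => omax (osucc ozero) (osup (fun i => omega_pow (f i)))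
  end.

(* The least element of a class of ordinals; [ozero] if the class is empty. *)
Definition ord_inf (P : ord -> Prop) : ord :=
  if pselect (exists a, P a /\ forall b, P b -> ord_le a b) is left h
  then projT1 (cid h) else ozero.

(* In the extension order on finite sequences, the predecessors of a node
   always form a finite chain, so this is not repeated as a condition. *)
Definition tree_on (X : eqType) (T : set (seq X)) : Prop :=
  [/\ countable T, T !=set0 & forall s, T s -> s != [::]].

Definition derived (X : eqType) (T : set (seq X)) : set (seq X) :=
  [set s | T s /\ exists t, [/\ T t, prefix s t & s != t]].

(* Derivation does not enlarge a tree, so the intersection over all the
   ordinals below a limit ordinal [osup f] is the intersection over the [f i];
   intersecting with T deals with the empty family. *)
Fixpoint derived_iter (X : eqType) (T : set (seq X)) (a : ord) : set (seq X) :=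
  match a with
  | ozero => T
  | osucc a' => derived (derived_iter T a')
  | osup _ f => [set s | T s /\ forall i, derived_iter T (f i) s]
  end.

(* Meaningful for well-founded T; for other T this is [ozero].  In a Banach
   space without a copy of l_1 all the trees considered below are
   well-founded. *)
Definition tree_order (X : eqType) (T : set (seq X)) : ord :=
  ord_inf (fun a => derived_iter T a = set0).

Section Banach.
Context {R : realType} (X : completeNormedModType R).

Definition schauder_basis (e : nat -> X) : Prop :=
  forall x : X, exists! a : nat -> R,
    (fun n : nat => \sum_(i < n) a i *: e i) @ \oo --> x.

Definition l1_seq (a : nat -> R) : Prop :=
  cvgn (series (fun i => `|a i|)).

Definition l1_norm (a : nat -> R) : R :=
  limn (series (fun i => `|a i|)).

(* F is an isomorphism of l_1 onto a subspace of X; its values outside l_1 are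
   irrelevant. *)
Definition contains_l1 : Prop :=
  exists F : (nat -> R) -> X,
    (forall (k : R) (a b : nat -> R), l1_seq a -> l1_seq b ->
       F (fun i => k * a i + b i) = k *: F a + F b) /\
    exists c C : R, [/\ 0 < c, 0 < C &
      forall a, l1_seq a ->
        c * l1_norm a <= `|F a| /\ `|F a| <= C * l1_norm a].

Definition l1_tree (K : R) (T : set (seq X)) : Prop :=
  [/\ tree_on T,
      forall s, T s -> forall x, x \in s -> `|x| = 1 &
      forall s, T s -> exists c C : R, [/\ 0 < c, 0 < C, c^-1 * C <= K &
        forall a : 'I_(size s) -> R,
          c * (\sum_i `|a i|) <= `|\sum_i a i *: s`_i| /\
          `|\sum_i a i *: s`_i| <= C * (\sum_i `|a i|)]].

(* a j lists the coefficients of the j-th vector of s. *)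
Definition block_basis (e : nat -> X) (s : seq X) : Prop :=
  exists (N : nat) (a : nat -> nat -> R),
    (forall j, (j < size s)%N ->
       s`_j != 0 /\ s`_j = \sum_(i < N) a j i *: e i) /\
    (forall j k, (j < k < size s)%N -> forall i l : 'I_N,
       a j i != 0 -> a k l != 0 -> (i < l)%N).

Definition l1_block_tree (e : nat -> X) (K : R) (T : set (seq X)) : Prop :=
  l1_tree K T /\ forall s, T s -> block_basis e s.

Definition l1_index_const (K : R) : ord :=
  osup (fun T : {T : set (seq X) | l1_tree K T} => tree_order (sval T)).

Definition l1_index : ord :=
  osup (fun K : {K : R | 1 <= K} => l1_index_const (sval K)).

Definition block_l1_index_const (e : nat -> X) (K : R) : ord :=
  osup (fun T : {T : set (seq X) | l1_block_tree e K T} =>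
          tree_order (sval T)).

Definition block_l1_index (e : nat -> X) : ord :=
  osup (fun K : {K : R | 1 <= K} => block_l1_index_const e (sval K)).

End Banach.

(* Main.v *)
Require Import Defs.
From HB Require Import structures.
From mathcomp Require Import all_boot all_order all_algebra.
From mathcomp Require Import all_classical all_reals all_analysis.
From mathcomp Require Import ring lra zify.

(** Block trees are trees, so only I(X) <= I_b(X) is at stake.  Write B for
    I_b(X).  The proof rests on three facts.

    Blocking ([l1_tree_block_tree]).  A tree of l_1-sequences of order at least
    omega * b yields a block tree of order at least b.  Cut the nodes into
    segments; a segment with more than n vectors has a nontrivial combination
    whose first n coordinates vanish, and a partial sum of the expansion of that
    combination is, after normalization, a block starting beyond n.  A uniformly
    small perturbation of l_1-normalized combinations keeps a lower
    l_1-estimate.  Each block consumes a finite segment whose length is known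
    only when its turn comes, that is, one factor omega of the order.

    Doubling ([block_tree_double]).  If a block tree has order at least
    omega * d, a limit, then deleting finitely many initial vectors does not
    lower this bound.  So the tails of the tree which start beyond the support
    of a node can be hung below that node, which gives order
    omega * d + omega * d.  The lower l_1-estimate of a concatenation follows
    from those of its two parts because the partial sum projections are
    uniformly bounded; this is Banach's theorem [basis_constant], proved here
    by a Baire category argument.

    Ordinal arithmetic ([omul_omega_absorb]).  Every ordinal c satisfies
    d <= c <= d + omega^n for some n and some d with omega * d = d
    ([omega_division]).  Hence an ordinal b that is at least every omega^n, and
    with each such d < b also bounds d + d, satisfies omega * b = b.

    Blocking and I(X) >= omega^omega make B at least every omega^n, and doubling
    gives the closure under d + d, so omega * B = B.  A tree of order above B
    would then give, by blocking, a block tree of order at least B and, by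
    doubling, one of order at least B + B > B.

    Orders of trees are handled through the ranks [has_rank] of nodes.  That X
    does not contain l_1 enters through [l1_tree_well_founded]: an infinite
    branch of an l_1-tree spans a copy of l_1. *)

Set Implicit Arguments.
Unset Strict Implicit.
Unset Printing Implicit Defensive.

Import Order.TTheory GRing.Theory Num.Theory.
Import numFieldNormedType.Exports.

Local Open Scope classical_set_scope.
Local Open Scope ring_scope.

(** * Ordinal notations *)

Local Notation olt a b := (ord_le (osucc a) b).

Lemma olt_of_mono (P Q : ord -> Prop) b :
  (forall c, P c -> Q c) -> olt_of P b -> olt_of Q b.
Proof.
by move=> PQ; elim: b => //= [b _ /PQ //|A g IH [i /IH ?]]; exists i.
Qed.

Lemma le_osup A (g : A -> ord) i a : ord_le a (g i) -> ord_le a (osup g).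
Proof. by elim: a => //= [a _ ?|B f IH H j]; [exists i|apply: IH]. Qed.

Lemma ord_le_refl a : ord_le a a.
Proof. by elim: a => //= A f IH i; apply: (@le_osup _ _ i). Qed.

Lemma ord_le_trans b a c : ord_le a b -> ord_le b c -> ord_le a c.
Proof.
elim: b a c => [|b IHb|B g IHb] a c.
- by elim: a => //= A f IH fle _ i; apply: IH.
- elim: a => //= [a _ ab bc|A f IH fle bc i]; last exact: IH.
  by apply: olt_of_mono bc => d; exact: IHb.
- elim: a => //= [a _ [i ab] bc|A f IH fle bc i]; last exact: IH.
  by have /= := IHb i (osucc a) c ab (bc i).
Qed.

Lemma ord_le_succ a : ord_le a (osucc a).
Proof.
elim: a => //= A f IH i; apply: ord_le_trans (IH i) _.
by apply: (@le_osup _ _ i); apply: ord_le_refl.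
Qed.

Lemma olt_le a b : olt a b -> ord_le a b.
Proof. exact: ord_le_trans (ord_le_succ a). Qed.

Lemma ord_le_total a b : ord_le a b \/ olt b a.
Proof.
elim: a b => [|a IHa|A f IHa] b; first by left.
- elim: b => [|b IHb|B g IHb] /=; first by right.
  + by have [?|?] := IHa b; [left|right].
  + case: (pselect (exists i, olt_of (ord_le a) (g i))) => [?|H]; first by left.
    by right => i; have [aj|//] := IHb i; case: H; exists i.
- case: (pselect (forall i, ord_le (f i) b)) => [?|]; first by left.
  move=> /existsNP[i fib]; right; exists i.
  by have [|] := IHa i b.
Qed.

Lemma ord_least (P : ord -> Prop) a :
  P a -> exists b, P b /\ forall c, P c -> ord_le b c.
Proof.
suff H : forall a x, olt x a -> P x ->
    exists b, P b /\ forall c, P c -> ord_le b c.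
  by move=> Pa; exact: (H (osucc a) a (ord_le_refl _)).
elim=> [//|d IH|A f IH] x /=; last by move=> [i]; exact: IH.
move=> xd Px.
case: (pselect (forall c, P c -> ord_le x c)) => [?|]; first by exists x.
move=> /existsNP[y /not_implyP[Py xy]]; apply: (IH y) => //.
by have [//|yx] := ord_le_total x y; exact: ord_le_trans xd.
Qed.

Lemma ord_lt_irrefl a : ~ olt a a.
Proof.
suff H : forall a b, olt b a -> ~ ord_le a b.
  by move=> aa; exact: (H a a aa (ord_le_refl _)).
elim=> [//|{}a IH|A f IH] b /=; last by move=> [i bi] fb; exact: (IH i b).
move=> ba ab.
exact: (IH a (@ord_le_trans b (osucc a) a ab ba) (ord_le_refl _)).
Qed.

Lemma le_omaxl a b : ord_le a (omax a b).
Proof.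
apply: (@le_osup _ (fun i : bool => if i then a else b) true).
exact: ord_le_refl.
Qed.

Lemma le_omaxr a b : ord_le b (omax a b).
Proof.
apply: (@le_osup _ (fun i : bool => if i then a else b) false).
exact: ord_le_refl.
Qed.

Lemma omax_le a b c : ord_le a c -> ord_le b c -> ord_le (omax a b) c.
Proof. by move=> ac bc []. Qed.

Lemma oadd_lel a b : ord_le a (oadd a b).
Proof.
elim: b => /= [|b IH|B g IH]; first exact: ord_le_refl.
- exact: ord_le_trans IH (ord_le_succ _).
- exact: le_omaxl.
Qed.

Lemma oadd_mono a a' b b' :
  ord_le a a' -> ord_le b b' -> ord_le (oadd a b) (oadd a' b').
Proof.
move=> aa'; elim: b b' => [|b IHb|B g IHb] b' /=.
- by move=> _; apply: ord_le_trans aa' (oadd_lel _ _).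
- elim: b' => //= [b' _ bb'|B' g' IH [i bi]]; first exact: IHb.
  by exists false, i; exact: IH.
- move=> gb'; apply: omax_le; first exact: ord_le_trans aa' (oadd_lel _ _).
  by move=> i; exact: IHb.
Qed.

Lemma omul_mono a a' b b' :
  ord_le a a' -> ord_le b b' -> ord_le (omul a b) (omul a' b').
Proof.
move=> aa'; elim: b b' => [//|b IHb|B g IHb] b' /=.
  elim: b' => [//|b' _ bb'|B' g' IH [i bi]] /=.
    by apply: oadd_mono => //; exact: IHb.
  by apply: (@le_osup _ _ i); apply: IH.
by move=> H i; exact: IHb.
Qed.

Lemma oadd_ler a b : ord_le b (oadd a b).
Proof.
elim: b => //= B g IH i; apply: ord_le_trans (IH i) _.
apply: ord_le_trans (le_omaxr _ _).
exact: (@le_osup _ (fun i => oadd a (g i)) i _ (ord_le_refl _)).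
Qed.

Lemma oadd_assoc_le a b c : ord_le (oadd (oadd a b) c) (oadd a (oadd b c)).
Proof.
elim: c => [|c IH|C f IH]; [exact: ord_le_refl|exact: IH|].
apply: omax_le => [|i].
  by apply: oadd_mono (ord_le_refl _) _; exact: le_omaxl.
apply: ord_le_trans (IH i) _; apply: oadd_mono (ord_le_refl _) _.
apply: ord_le_trans (le_omaxr _ _).
exact: (@le_osup _ (fun i => oadd b (f i)) i _ (ord_le_refl _)).
Qed.

Lemma omul_distr_le a b c :
  ord_le (omul a (oadd b c)) (oadd (omul a b) (omul a c)).
Proof.
elim: c => [|c IH|C f IH]; first exact: ord_le_refl.
- apply: ord_le_trans (oadd_assoc_le _ _ _).
  by apply: oadd_mono (ord_le_refl _); exact: IH.
- case => [|i]; first exact: oadd_lel.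
  apply: ord_le_trans (IH i) _; apply: oadd_mono (ord_le_refl _) _.
  exact: (@le_osup _ (fun i => omul a (f i)) i _ (ord_le_refl _)).
Qed.

Local Notation ofin n := (iter n osucc ozero).

Lemma ofin_le_omega n : ord_le (ofin n) omega.
Proof. exact: (@le_osup _ (fun n => ofin n) n _ (ord_le_refl _)). Qed.

Lemma le_omul_omega d : ord_le d (omul omega d).
Proof.
elim: d => [//|d IH|A f IH].
- change (ord_le (oadd d (ofin 1)) (oadd (omul omega d) omega)).
  exact: oadd_mono IH (ofin_le_omega 1).
- by move=> i; apply: (@le_osup _ (fun i => omul omega (f i)) i); exact: IH.
Qed.

Local Notation omega_fpow n := (omega_pow (ofin n)).

(** In [omega_pow] the new factor omega comes on the right, here it is on the
    left: finite powers of omega commute with omega. *)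
Lemma omul_omega_pow n : ord_le (omul omega (omega_fpow n)) (omega_fpow n.+1).
Proof.
elim: n => [|n IH].
  apply: omax_le => [//|k].
  apply: (@le_osup _ (fun k => omul (osucc ozero) (ofin k)) k).
  by elim: k.
move=> k.
have H : ord_le (omul omega (omul (omega_fpow n) (ofin k)))
     (omul (omul omega (omega_fpow n)) (ofin k)).
  elim: k => // k IHk; apply: ord_le_trans (omul_distr_le _ _ _) _.
  by apply: oadd_mono (ord_le_refl _); exact: IHk.
apply: ord_le_trans H _; apply: omul_mono (ofin_le_omega k).
exact: IH.
Qed.

Lemma omega_pow_double n :
  ord_le (oadd (omega_fpow n) (omega_fpow n)) (omega_fpow n.+1).
Proof.
apply: (@le_osup _ (fun k => omul (omega_fpow n) (ofin k)) 2%N).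
by apply: oadd_mono (ord_le_refl _); exact: oadd_ler.
Qed.

Lemma omega_pow_gt0 n : olt ozero (omega_fpow n).
Proof.
elim: n => [//|n IH]; apply: (ord_le_trans IH).
exact: ord_le_trans (oadd_lel _ _) (omega_pow_double n).
Qed.

Lemma olt_oadd a b c : ord_le a b -> olt ozero c -> olt a (oadd b c).
Proof. by move=> ab c0; exact: (oadd_mono (b := osucc ozero) ab c0). Qed.

Lemma olt_omega_pow n : olt (omega_fpow n) (omega_fpow n.+1).
Proof.
apply: (ord_le_trans _ (omega_pow_double n)).
exact: (olt_oadd (ord_le_refl _) (omega_pow_gt0 n)).
Qed.

Lemma omega_pow_le_omega_pow_omega n :
  ord_le (omega_fpow n) (omega_pow omega).
Proof.
apply: ord_le_trans (le_omaxr _ _).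
exact: (@le_osup _ (fun n => omega_fpow n) n _ (ord_le_refl _)).
Qed.

(** A multiple of omega is zero or a limit. *)
Lemma olt_succ_omul_omega x d :
  olt x (omul omega d) -> olt (osucc x) (omul omega d).
Proof.
elim: d => [//|d IH|A f IH] /=; last by move=> [i xi]; exists i; exact: IH.
case=> -[xd|[k xk]].
- by exists true; exact: IH.
- by exists false, k.+1.
Qed.

(** This is division of c by omega^omega, the quotient being recorded only
    through d.  For c the supremum of the c_i, either c is within some omega^n
    of the supremum d of the d_i, or c is d + omega^omega, which again does not
    grow under multiplication by omega on the left. *)
Lemma omega_division c : exists d n,
  [/\ ord_le (omul omega d) d, ord_le d c & ord_le c (oadd d (omega_fpow n))].
Proof.
elim: c => [|c [d [n [dd dc cd]]]|A f IH].
- by exists ozero, 0%N.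
- exists d, n.+1; split => //; first exact: ord_le_trans dc (ord_le_succ _).
  apply: (@ord_le_trans (oadd d (oadd (omega_fpow n) (ofin 1)))).
    exact: cd.
  apply: oadd_mono (ord_le_refl _) _; apply: ord_le_trans (omega_pow_double n).
  by apply: oadd_mono (ord_le_refl _) _; exact: omega_pow_gt0.
have [D HD] := choice IH; have [N HN] := choice HD.
pose d := osup D.
have dd : ord_le (omul omega d) d.
  move=> i; apply: (@le_osup _ _ i); by have [] := HN i.
have df : ord_le d (osup f).
  by move=> i; apply: (@le_osup _ _ i); have [] := HN i.
have fd i : ord_le (f i) (oadd d (omega_fpow (N i))).
  have [_ _ fi] := HN i; apply: ord_le_trans fi _.
  apply: oadd_mono (ord_le_refl _).
  exact: (@le_osup _ _ i _ (ord_le_refl _)).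
case: (pselect (exists n, ord_le (osup f) (oadd d (omega_fpow n)))).
  by move=> [n fn]; exists d, n.
(* The supremum of the d + omega^n stands for d + omega^omega. *)
move=> nofn; exists (osup (fun n => oadd d (omega_fpow n))), 0%N; split.
- move=> n; apply: ord_le_trans (omul_distr_le _ _ _) _.
  apply: (@le_osup _ (fun n => oadd d (omega_fpow n)) n.+1).
  by apply: oadd_mono => //; exact: omul_omega_pow.
- move=> n; have [fn|] := ord_le_total (osup f) (oadd d (omega_fpow n)).
    by case: nofn; exists n.
  exact: olt_le.
- move=> i; apply: ord_le_trans (oadd_lel _ _).
  exact: (@le_osup _ (fun n => oadd d (omega_fpow n)) (N i)).
Qed.

(** Take d <= b <= d + omega^n with omega * d = d.  If d < b, the product
    omega * b is at most d + omega^(n+1), hence at most twice the larger of d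
    and omega^(n+1), which b bounds in either case. *)
Lemma omul_omega_absorb b :
  (forall n, ord_le (omega_fpow n) b) ->
  (forall d, ord_le (omul omega d) d -> olt d b -> ord_le (oadd d d) b) ->
  ord_le (omul omega b) b.
Proof.
move=> powb dbl; have [d [n [dd db bd]]] := omega_division b.
have [bled|ltdb] := ord_le_total b d.
  apply: ord_le_trans db; apply: ord_le_trans dd.
  exact: omul_mono (ord_le_refl _) bled.
apply: ord_le_trans (omul_mono (ord_le_refl _) bd) _.
apply: ord_le_trans (omul_distr_le _ _ _) _.
apply: (@ord_le_trans (oadd d (omega_fpow n.+1))).
  by apply: oadd_mono dd _; exact: omul_omega_pow.
have [dw|/olt_le wd] := ord_le_total d (omega_fpow n.+1).
- apply: ord_le_trans (powb n.+2); apply: ord_le_trans (omega_pow_double _).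
  exact: oadd_mono dw (ord_le_refl _).
- by apply: ord_le_trans (dbl d dd ltdb); exact: oadd_mono (ord_le_refl _) wd.
Qed.

(** * Ranks of nodes and the order of a tree *)

Section Rank.
Context {X : eqType}.
Implicit Types (T : set (seq X)) (s t u : seq X).

Definition extends s t : Prop := prefix s t /\ s != t.

Lemma extendsP s t : extends s t <-> exists u, u != [::] /\ t = s ++ u.
Proof.
split=> [[/prefixP[u ->] ne]|[u [u0 ->]]].
  by exists u; split=> //; apply: contraNneq ne => ->; rewrite cats0.
split; first exact: prefix_prefix.
by rewrite -{1}(cats0 s) eqseq_cat // eqxx eq_sym.
Qed.

(** Since s itself need not belong to T, the empty sequence may serve as a root;
    the order of a well-founded T is the largest rank of this root. *)
Fixpoint has_rank T (a : ord) s : Prop :=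
  match a with
  | ozero => True
  | osucc a' => exists t, [/\ T t, extends s t & has_rank T a' t]
  | osup _ f => forall i, has_rank T (f i) s
  end.

Lemma has_rank_le T a b s : ord_le a b -> has_rank T b s -> has_rank T a s.
Proof.
elim: a b s => [//|a IHa|A f IHa] b s; last first.
  by move=> fb sb i; exact: IHa (fb i) sb.
elim: b => [//|b _|B g IHb].
- by move=> ab [t [Tt st tb]]; exists t; split=> //; exact: IHa tb.
- by move=> [i ai] sb; exact: IHb ai (sb i).
Qed.

Lemma has_rank_prefix T a s t :
  prefix s t -> has_rank T a t -> has_rank T a s.
Proof.
move=> st; elim: a => //= [a _ [u [Tu [tu ntu] ua]]|A f IH H i]; last exact: IH.
exists u; split=> //; split; first exact: prefix_trans tu.
apply: contraNneq ntu => su; move: st tu; rewrite -{}su.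
move=> /prefixP[v ->] /prefixP[w]; rewrite -catA => /eqP.
rewrite -{1}[s]cats0 eqseq_cat// => /andP[_]; rewrite eq_sym.
by case: v => //=; rewrite cats0.
Qed.

Lemma has_rank_subset T T' a s :
  T `<=` T' -> has_rank T a s -> has_rank T' a s.
Proof.
move=> TT'; elim: a s => //= [a IH s [t [/TT' Tt st ta]]|A f IH s H i].
  by exists t; split=> //; exact: IH.
exact: IH.
Qed.

Lemma has_rank_oadd T a k s : has_rank T (oadd a (ofin k)) s ->
  exists u, [/\ (k <= size u)%N, u = [::] \/ T (s ++ u) &
    has_rank T a (s ++ u)].
Proof.
elim: k s => [|k IH] s; first by exists [::]; split; rewrite ?cats0//; left.
move=> [t [Tt /extendsP[v [v0 tE]] /IH[u [ku Tu ua]]]].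
exists (v ++ u); rewrite catA -tE; split=> //; last first.
  by right; case: Tu => [->|//]; rewrite cats0.
by rewrite size_cat -add1n leq_add// lt0n size_eq0.
Qed.

Lemma has_rank_limit T c s :
  (forall x, olt x c -> has_rank T (osucc x) s) -> has_rank T c s.
Proof.
elim: c => [//|c _ H|A f IH H i]; first exact: (H c (ord_le_refl _)).
by apply: IH => x xf; apply: H; exists i.
Qed.

Lemma derived_iterE T a s : derived_iter T a s <-> T s /\ has_rank T a s.
Proof.
elim: a s => [|a IH|A f IH] s; first by split=> [|[]].
- split=> [[/IH[Ts sa] [t [/IH[Tt ta] pst st]]]|[Ts [t [Tt st ta]]]].
    by split=> //; exists t; split.
  split.
    by apply/IH; split=> //; apply: (has_rank_le (ord_le_succ a)); exists t.
  by exists t; split; [apply/IH| exact: st.1|exact: st.2].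
- split=> [[Ts H]|[Ts H]]; split=> // i; first by have /IH[] := H i.
  by apply/IH; split=> //; exact: H.
Qed.

Lemma derived_iter_set0 T a : (forall s, T s -> s != [::]) ->
  derived_iter T a = set0 <-> ~ has_rank T (osucc a) [::].
Proof.
move=> T0; split=> [Ta0 [t [Tt _ ta]]|H].
  by have : derived_iter T a t by [apply/derived_iterE]; rewrite Ta0.
apply/seteqP; split=> // s /derived_iterE[Ts sa].
apply: H; exists s; split=> //.
by split; [exact: prefix0s|rewrite eq_sym T0].
Qed.

Lemma has_rank_set0 b s : has_rank (@set0 (seq X)) b s -> ord_le b ozero.
Proof. by elim: b => [//|b _ [t []]//|B g IH H i]; exact: IH. Qed.

Lemma tree_order_least T a : derived_iter T a = set0 ->
  derived_iter T (tree_order T) = set0 /\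
  forall b, derived_iter T b = set0 -> ord_le (tree_order T) b.
Proof.
move=> Ta0; rewrite /tree_order /ord_inf.
case: pselect => [h|[]]; first by case: (cid h).
exact: (@ord_least (fun a => derived_iter T a = set0) a).
Qed.

(** The hypothesis that some derived tree is empty is what well-foundedness
    provides; without it [tree_order] is the default value [ozero]. *)
Lemma le_tree_order T a b : (forall s, T s -> s != [::]) ->
  derived_iter T a = set0 -> ord_le b (tree_order T) <-> has_rank T b [::].
Proof.
move=> T0 /tree_order_least.
set o := tree_order T; move=> [To omin].
have no : ~ has_rank T (osucc o) [::] by apply/derived_iter_set0.
split=> [|bT]; last first.
  by have [//|ob] := ord_le_total b o; case: no; exact: has_rank_le ob bT.
elim: b => [//|b _ bo|B g IH go i]; last exact: IH (go i).
apply: contrapT => /(derived_iter_set0 _ T0)/omin ob.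
exact: ord_lt_irrefl (ord_le_trans bo ob).
Qed.

(** If the root is accessible for the relation of being an extension in T, its
    rank is bounded, by induction on accessibility; otherwise dependent choice
    produces an infinite branch. *)
Lemma well_founded_tree_order T :
  (forall u : nat -> seq X, (forall n, T (u n.+1)) ->
     ~ forall n, extends (u n) (u n.+1)) ->
  (forall s, T s -> s != [::]) ->
  exists a, derived_iter T a = set0.
Proof.
move=> wfT T0.
pose R t s := T t /\ extends s t.
case: (pselect (Acc R [::])) => [acc|nacc].
  have [a na] : exists a, ~ has_rank T a [::].
    elim: acc => {}s _ IH.
    have /choice[a Ha] : forall t : {t | R t s},
        exists a, ~ has_rank T a (sval t).
      by move=> [t ts]; exact: IH ts.
    exists (osucc (osup a)) => -[t [Tt st ta]].
    exact: (Ha (exist _ t (conj Tt st)) (ta (exist _ t (conj Tt st)))).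
  exists a; apply/derived_iter_set0 => // aT; apply: na.
  exact: has_rank_le (ord_le_succ a) aT.
have step (s : {s | ~ Acc R s}) :
    exists t : {t | ~ Acc R t}, R (sval t) (sval s).
  case: s => s ns /=; apply: contrapT => H; apply: ns; constructor => t ts.
  by apply: contrapT => nt; apply: H; exists (exist _ t nt).
have [f Hf] := choice step.
pose u n := sval (iter n f (exist _ [::] nacc)).
by case: (wfT u) => n; have [] := Hf (iter n f (exist _ [::] nacc)).
Qed.

End Rank.

(** * Lower l_1-estimates *)

Section LowerL1.
Context {R : realType} {X : completeNormedModType R}.
Implicit Types (s t : seq X) (K : R).

Definition lower_l1 (c : R) s : Prop := forall a : nat -> R,
  c * (\sum_(0 <= i < size s) `|a i|) <= `|\sum_(0 <= i < size s) a i *: s`_i|.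

Lemma big_nat_split (V : nmodType) m n (F : nat -> V) :
  \sum_(0 <= i < m + n) F i =
  \sum_(0 <= i < m) F i + \sum_(0 <= i < n) F (m + i)%N.
Proof.
rewrite (big_cat_nat (leq0n m) (leq_addr n m)) /=; congr (_ + _).
by rewrite -{1}(add0n m) big_addn addKn; apply: eq_bigr => i _; rewrite addnC.
Qed.

Lemma coef_cat s t (a b : nat -> R) : exists d : nat -> R,
  \sum_(0 <= i < size (s ++ t)) `|d i| =
    \sum_(0 <= i < size s) `|a i| + \sum_(0 <= i < size t) `|b i| /\
  \sum_(0 <= i < size (s ++ t)) d i *: (s ++ t)`_i =
    \sum_(0 <= i < size s) a i *: s`_i + \sum_(0 <= i < size t) b i *: t`_i.
Proof.
exists (fun i => if (i < size s)%N then a i else b (i - size s)%N).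
rewrite size_cat !big_nat_split; split; congr (_ + _).
- by apply: eq_big_nat => i /andP[_ ->].
- by apply: eq_bigr => i _; rewrite ltnNge leq_addr addKn.
- by apply: eq_big_nat => i /andP[_ si]; rewrite si nth_cat si.
- by apply: eq_bigr => i _; rewrite nth_cat ltnNge leq_addr addKn.
Qed.

Lemma lower_l1_cat c s t : lower_l1 c (s ++ t) <-> forall a b : nat -> R,
  c * (\sum_(0 <= i < size s) `|a i| + \sum_(0 <= i < size t) `|b i|) <=
  `|\sum_(0 <= i < size s) a i *: s`_i + \sum_(0 <= i < size t) b i *: t`_i|.
Proof.
split=> [st a b|st a]; first by have [d [<- <-]] := coef_cat s t a b.
have := st a (fun i => a (size s + i)%N); rewrite size_cat !big_nat_split.
congr (_ <= `|_ + _|).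
- by apply: eq_big_nat => i /andP[_ si]; rewrite nth_cat si.
- by apply: eq_bigr => i _; rewrite nth_cat ltnNge leq_addr addKn.
Qed.

Lemma lower_l1_catl c s t : lower_l1 c (s ++ t) -> lower_l1 c s.
Proof.
move=> /lower_l1_cat st a; have := st a (fun=> 0).
rewrite [X in _ + X]big1 => [|i _]; last by rewrite normr0.
by rewrite [X in _ <= `|_ + X|]big1 => [|i _]; rewrite ?addr0// scale0r.
Qed.

Lemma lower_l1_catr c s t : lower_l1 c (s ++ t) -> lower_l1 c t.
Proof.
move=> /lower_l1_cat st a; have := st (fun=> 0) a.
rewrite [X in X + _]big1 => [|i _]; last by rewrite normr0.
by rewrite [X in _ <= `|X + _|]big1 => [|i _]; rewrite ?add0r// scale0r.
Qed.

(** The nodes consist of unit vectors, so C >= 1 and c >= C / K >= 1 / K. *)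
Lemma l1_tree_lower K (T : set (seq X)) s :
  l1_tree K T -> T s -> lower_l1 K^-1 s.
Proof.
move=> [[_ _ T0] T1 TK] Ts a.
have [c [C [c0 C0 cCK H]]] := TK s Ts.
have s0 : (0 < size s)%N by rewrite lt0n size_eq0; exact: T0.
have Hn b : c * (\sum_(0 <= i < size s) `|b i|) <=
     `|\sum_(0 <= i < size s) b i *: s`_i| /\
   `|\sum_(0 <= i < size s) b i *: s`_i| <= C * (\sum_(0 <= i < size s) `|b i|).
  by rewrite !big_mkord; exact: H (fun i => b (nat_of_ord i)).
have C1 : 1 <= C.
  have [_] := Hn (fun i => (i == 0)%:R).
  rewrite !(big_ltn s0) /= [X in _ + X]big_nat_cond.
  rewrite [X in _ + X]big1 ?addr0; last first.
    by move=> [//|i] _; rewrite scale0r.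
  rewrite [X in _ * (_ + X)]big_nat_cond.
  rewrite [X in _ * (_ + X)]big1 ?addr0; last first.
    by move=> [//|i] _; rewrite normr0.
  by rewrite scale1r normr1 mulr1 (T1 s Ts)// mem_nth.
have K0 : 0 < K by apply: lt_le_trans cCK; rewrite mulr_gt0// invr_gt0.
have [+ _] := Hn a; apply: le_trans; apply: ler_wpM2r.
  by apply: sumr_ge0.
rewrite invf_ple ?posrE// (le_trans _ cCK)//.
by rewrite ler_peMr// invr_ge0 ltW.
Qed.

Lemma lower_l1_tree K c (T : set (seq X)) : 0 < c -> c^-1 <= K ->
  countable T -> T !=set0 -> (forall s, T s -> s != [::]) ->
  (forall s, T s -> forall x, x \in s -> `|x| = 1) ->
  (forall s, T s -> lower_l1 c s) -> l1_tree K T.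
Proof.
move=> c0 cK cT T0 Tn T1 Tc; split=> // s Ts.
exists c, 1; split=> //; first by rewrite mulr1.
move=> a; split.
  have := Tc s Ts (fun i => if insub i is Some j then a j else 0).
  rewrite !big_mkord; under eq_bigr => i _ do rewrite valK.
  by under [in X in _ <= `|X|]eq_bigr => i _ do rewrite valK.
rewrite mul1r (le_trans (ler_norm_sum _ _ _))//; apply: ler_sum => i _.
by rewrite normrZ (T1 s Ts) ?mulr1// mem_nth.
Qed.

Lemma lower_l1_contains_l1 c (x : nat -> X) : 0 < c ->
  (forall n, `|x n| = 1) ->
  (forall n (a : nat -> R), c * (\sum_(0 <= i < n) `|a i|) <=
     `|\sum_(0 <= i < n) a i *: x i|) ->
  contains_l1 X.
Proof.
move=> c0 x1 xc.
pose f (a : nat -> R) i := a i *: x i.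
have nf a : [normed series (f a)] = series (fun i => `|a i|).
  apply/funext => n; rewrite /normed_series_of /series /=.
  by apply: eq_bigr => i _; rewrite /= /f normrZ x1 mulr1.
have cf : forall a : nat -> R, l1_seq a -> cvgn (series (f a)).
  by move=> a la; apply: normed_cvg; rewrite nf.
exists (fun a => limn (series (f a))); split.
  move=> k a b la lb.
  have -> : f (fun i => k * a i + b i) = (k *: f a) + f b.
    by apply/funext => i; rewrite /f scalerDl -scalerA.
  rewrite seriesD seriesZ limD ?limZl_tmp//; try exact: cf.
  exact: cvgZl_tmp (cf a la).
exists c, 1; split=> // a la; split.
  have cL : (fun n => c * series (fun i => `|a i|) n) @ \oo --> c * l1_norm a.
    by apply: cvgM => //; exact: cvg_cst.
  have cF : (fun n => `|series (f a) n|) @ \oo --> `|limn (series (f a))|.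
    exact: cvg_norm (cf a la).
  rewrite -(cvg_lim _ cL)// -(cvg_lim _ cF)//.
  apply: ler_lim; [exact: cvgP cL|exact: cvgP cF|].
  by near=> n => /=; exact: xc.
by rewrite mul1r /l1_norm -nf; apply: lim_series_norm; rewrite nf.
Unshelve. all: by end_near. Qed.

(** Every initial segment of an infinite branch satisfies the lower estimate
    with the same constant 1 / K, so the branch is an infinite l_1-sequence. *)
Lemma l1_tree_well_founded K (T : set (seq X)) : ~ contains_l1 X -> 0 < K ->
  l1_tree K T -> exists a, derived_iter T a = set0.
Proof.
move=> nl1 K0 TK; have [[_ _ T0] T1 _] := TK.
apply: well_founded_tree_order T0 => u Tu ext; apply: nl1.
have psz n : prefix (u n) (u n.+1) by have [] := ext n.
have pre n m : (n <= m)%N -> prefix (u n) (u m).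
  move=> /subnK<-; elim: (m - n)%N => [|k IH]; first exact: prefix_refl.
  by rewrite addSn; exact: prefix_trans IH (psz _).
have sz n : (n <= size (u n))%N.
  elim: n => // n IH; apply: leq_ltn_trans IH _.
  have /extendsP[v [v0 ->]] := ext n.
  by rewrite size_cat -addn1 leq_add2l lt0n size_eq0.
pose x n := (u n.+1)`_n.
have xE i n : (i < n)%N -> x i = (u n)`_i.
  move=> lt; have /prefixP[v ->] := pre i.+1 n lt.
  by rewrite nth_cat sz.
apply: (@lower_l1_contains_l1 K^-1 x) => [|n|n a]; first by rewrite invr_gt0.
  by apply: (T1 (u n.+1)) => //; rewrite mem_nth.
have : lower_l1 K^-1 (take n (u n.+1)).
  apply: (@lower_l1_catl _ _ (drop n (u n.+1))); rewrite cat_take_drop.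
  exact: l1_tree_lower TK (Tu n).
have szt : size (take n (u n.+1)) = n by rewrite size_takel// ltnW.
move=> /(_ a); rewrite szt => /le_trans; apply.
rewrite le_eqVlt; apply/orP; left; apply/eqP; congr `|_|.
by apply: eq_big_nat => i /andP[_ ni]; rewrite nth_take// (xE _ n.+1)// ltnW.
Qed.

End LowerL1.

(** * Schauder bases and the basis constant *)

Section Basis.
Context {R : realType} {X : completeNormedModType R} (e : nat -> X).
Hypothesis basis_e : schauder_basis e.

Definition lincomb (n : nat) (a : nat -> R) : X := \sum_(i < n) a i *: e i.

Definition coord (x : X) : nat -> R := sval (cid (basis_e x)).

Lemma coord_cvg x : lincomb ^~ (coord x) @ \oo --> x.
Proof. by rewrite /coord; case: cid => a /= []. Qed.

Lemma coord_unique x a : lincomb ^~ a @ \oo --> x -> coord x = a.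
Proof. by rewrite /coord; case: cid => b /= [_]; apply. Qed.

Lemma lincombP n k a b :
  lincomb n (fun i => k * a i + b i) = k *: lincomb n a + lincomb n b.
Proof.
rewrite /lincomb scaler_sumr -big_split; apply: eq_bigr => i _ /=.
by rewrite scalerDl scalerA.
Qed.

Lemma coordP k x y i : coord (k *: x + y) i = k * coord x i + coord y i.
Proof.
rewrite (@coord_unique _ (fun i => k * coord x i + coord y i))//.
rewrite (_ : lincomb ^~ _ =
  fun n => k *: lincomb n (coord x) + lincomb n (coord y)).
  by apply: cvgD; [apply: cvgZl_tmp|]; exact: coord_cvg.
by apply/funext => n; exact: lincombP.
Qed.

Lemma lincomb_cat n m a : lincomb (n + m) a =
  lincomb n a + \sum_(i < m) a (n + i)%N *: e (n + i)%N.
Proof. by rewrite /lincomb big_split_ord. Qed.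

(** From index n on, the partial sums of the coefficients cut off at n are
    constant, so uniqueness of the expansion applies. *)
Lemma coord_lincomb n a i :
  coord (lincomb n a) i = if (i < n)%N then a i else 0.
Proof.
rewrite (@coord_unique _ (fun i => if (i < n)%N then a i else 0))//.
apply: cvg_near_cst; near=> m.
have nm : (n <= m)%N by near: m; exact: nbhs_infty_ge.
rewrite -(subnKC nm) lincomb_cat big1 ?addr0; last first.
  by move=> j _; rewrite ltnNge leq_addr/= scale0r.
by apply: eq_bigr => j _; rewrite ltn_ord.
Unshelve. all: by end_near. Qed.

Definition partial_sum (n : nat) (x : X) : X := lincomb n (coord x).

Lemma partial_sumP n k x y :
  partial_sum n (k *: x + y) = k *: partial_sum n x + partial_sum n y.
Proof.
by rewrite /partial_sum -lincombP; apply: eq_bigr => i _; rewrite coordP.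
Qed.

Lemma partial_sumD n x y :
  partial_sum n (x + y) = partial_sum n x + partial_sum n y.
Proof. by rewrite -{1}[x]scale1r partial_sumP scale1r. Qed.

Lemma coord0 i : coord 0 i = 0.
Proof.
have := coordP 1 0 0 i; rewrite scaler0 addr0 mul1r => /eqP.
by rewrite -subr_eq subrr eq_sym => /eqP.
Qed.

Lemma partial_sum0 n : partial_sum n 0 = 0.
Proof.
by rewrite /partial_sum /lincomb big1// => i _; rewrite coord0 scale0r.
Qed.

Lemma partial_sumB n x y :
  partial_sum n (x - y) = partial_sum n x - partial_sum n y.
Proof. by rewrite addrC -scaleN1r partial_sumP scaleN1r addrC. Qed.

Lemma partial_sumZ n k x : partial_sum n (k *: x) = k *: partial_sum n x.
Proof. by rewrite -[k *: x]addr0 partial_sumP partial_sum0 addr0. Qed.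

Lemma basis_neq0 i : e i != 0.
Proof.
apply/eqP => ei; have := coord_lincomb i.+1 (fun j => (j == i)%:R) i.
rewrite ltnSn eqxx /lincomb big1 ?coord0 => [/esym/eqP|j _].
  by rewrite oner_eq0.
by case: eqVneq => [->|_]; rewrite ?ei ?scaler0 ?scale0r.
Qed.

Definition partial_sum_le (c : R) (x : X) := forall n, `|partial_sum n x| <= c.

Lemma coord_le c x i :
  partial_sum_le c x -> `|coord x i| <= `|e i|^-1 * (c + c).
Proof.
move=> xc; rewrite -ler_pdivrMl ?invr_gt0 ?normr_gt0 ?basis_neq0//.
rewrite invrK mulrC -normrZ.
have -> : coord x i *: e i = partial_sum i.+1 x - partial_sum i x.
  by rewrite /partial_sum /lincomb big_ord_recr/= addrAC subrr add0r.
by apply: le_trans (ler_normB _ _) _; apply: lerD.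
Qed.

(** The sets of vectors whose partial sums are bounded by k cover X, so by
    Baire's theorem the closure of one of them contains a ball; being convex and
    symmetric, it also contains a ball around 0, and scaling does the rest. *)
Lemma partial_sum_approx :
  exists2 c : R, 0 <= c & forall (y : X) (d : R), 0 < d ->
  exists2 a, partial_sum_le (c * `|y|) a & `|y - a| <= d.
Proof.
pose A k := [set x | partial_sum_le k%:R x].
have [k [x0 [r r0 rA]]] : exists k x0,
    exists2 r : R, 0 < r & ball x0 r `<=` closure (A k).
  apply: contrapT => H.
  suff : dense (\bigcap_k ~` closure (A k)).
    move=> /(_ setT) []; [by exists 0|exact: openT|].
    move=> x [_ xA].
    have [M Mx] : exists M, forall n, `|partial_sum n x| <= M.
      have /cvg_seq_bounded [M [_ HM]] := cvgP _ (@coord_cvg x).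
      exists (M + 1) => n; apply: (HM (M + 1)) => //; by rewrite ltrDl.
    apply: (xA (Num.bound `|M|)) => //; apply: subset_closure => n.
    apply: le_trans (Mx n) _; apply: le_trans (ler_norm _) _.
    by apply: ltW; exact: archi_boundP.
  apply: Baire => k; split; first exact/closed_openC/closed_closure.
  apply: contrapT => /denseNE [U [[x [Ux xU]] UA]].
  apply: H.
  have /nbhs_ballP[r r0 rU] : nbhs x U by exact: open_nbhs_nbhs.
  exists k, x; exists r => // y /rU Uy; apply: contrapT => nAy.
  by have : (U `&` ~` closure (A k)) y by []; rewrite UA.
have shift (z : X) d : 0 < d -> `|z| < r ->
    exists2 a, A k a & `|x0 + z - a| < d.
  move=> d0 zr; have /rA : ball x0 r (x0 + z).
    by rewrite -ball_normE /ball_/= opprD addNKr normrN.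
  move=> /(_ (ball (x0 + z) d)) []; first exact: nbhsx_ballx.
  by move=> a [Aa]; rewrite -ball_normE; exists a.
(* Half the difference of approximants to x0 + z and x0 - z approximates z. *)
have half (z : X) d : 0 < d -> `|z| < r -> exists2 a, A k a & `|z - a| <= d.
  move=> d0 zr; have [a Aa za] := shift z d d0 zr.
  have nzr : `|- z| < r by rewrite normrN.
  have [b Ab zb] := shift (- z) d d0 nzr.
  exists (2^-1 *: (a - b)).
    move=> n; rewrite partial_sumZ partial_sumB normrZ gtr0_norm//.
    rewrite -ler_pdivlMl ?invrK//.
    by rewrite mulr_natl mulr2n; apply: le_trans (ler_normB _ _) _; apply: lerD.
  have -> : z - 2^-1 *: (a - b) = 2^-1 *: ((x0 + z - a) - (x0 - z - b)).
    have -> : (x0 + z - a) - (x0 - z - b) = (z + z) - (a - b).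
      by rewrite !opprD !opprK addrACA (addrACA x0) subrr add0r.
    rewrite -mulr2n -[z *+ 2]scaler_nat [RHS]scalerBr scalerA mulVf//.
    by rewrite scale1r.
  rewrite normrZ gtr0_norm// -ler_pdivlMl ?invrK//.
  rewrite mulr_natl mulr2n; apply: le_trans (ler_normB _ _) _.
  by apply: lerD; exact: ltW.
exists (k%:R * (2 / r)); first by rewrite mulr_ge0// divr_ge0// ltW.
move=> y d d0; have [->|y0] := eqVneq y 0.
  exists 0; last by rewrite subr0 normr0 ltW.
  by move=> n; rewrite partial_sum0 normr0 mulr0.
have ny : 0 < `|y| by rewrite normr_gt0.
pose l := r / 2 / `|y|.
have l0 : 0 < l by rewrite !divr_gt0.
have lr : `|l *: y| < r.
  rewrite normrZ gtr0_norm// divfK ?gt_eqF//.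
  by rewrite ltr_pdivrMr// ltr_pMr// ltr1n.
have [a Aa ya] := half (l *: y) (l * d) (mulr_gt0 l0 d0) lr.
exists (l^-1 *: a).
  move=> n; rewrite partial_sumZ normrZ gtr0_norm ?invr_gt0//.
  rewrite -ler_pdivlMl ?invr_gt0// invrK.
  apply: le_trans (Aa n) _.
  rewrite le_eqVlt; apply/orP; left; apply/eqP.
  by rewrite /l; field; rewrite !gt_eqF.
have -> : y - l^-1 *: a = l^-1 *: (l *: y - a).
  by rewrite scalerBr scalerA mulVf ?gt_eqF// scale1r.
rewrite normrZ gtr0_norm ?invr_gt0//.
by rewrite -ler_pdivlMl ?invr_gt0// invrK.
Qed.

Lemma exists_halving (c d : R) : 0 < d -> exists J, c / 2 ^+ J <= d.
Proof.
move=> d0; exists (Num.bound `|c / d|).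
rewrite ler_pdivrMr ?exprn_gt0// mulrC -ler_pdivrMr//.
apply: le_trans (ler_norm _) _.
apply: le_trans (ltW (archi_boundP (normr_ge0 _))) _.
by rewrite -natrX ler_nat ltnW// ltn_expl.
Qed.

Lemma series_halving (V : completeNormedModType R) (u : nat -> V) c :
  (forall j, `|u j| <= c / 2 ^+ j) -> cvgn (series u).
Proof.
move=> uc; apply: normed_cvg.
apply: (@series_le_cvg _ _ (geometric c 2^-1)) => //.
- by move=> n /=.
- by move=> n; rewrite /= exprVn (le_trans _ (uc n)).
- by move=> n; rewrite /= exprVn.
- by apply: is_cvg_geometric_series; rewrite gtr0_norm// invf_lt1// ltr1n.
Qed.

Lemma cvgn_norm_sub (V : normedModType R) (u : nat -> V) l v c :
  u @ \oo --> l -> (\forall n \near \oo, `|u n - v| <= c) -> `|l - v| <= c.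
Proof.
move=> ul uc; have H : (fun n => `|u n - v|) @ \oo --> `|l - v|.
  by apply: cvg_norm; apply: cvgB => //; exact: cvg_cst.
rewrite -(cvg_lim _ H)//; apply: limr_le => //; exact: cvgP H.
Qed.

(** As in the proof of the open mapping theorem, [partial_sum_approx] is used
    repeatedly to write x as the sum of a series of vectors a_j whose partial
    sums are bounded by c |x| / 2^j.  The coordinates of the a_j can be summed
    over j, and the resulting coefficients alpha expand x, because the partial
    sums converge in j uniformly in n.  By uniqueness alpha gives the
    coordinates of x, and the bound follows by summing over j. *)
Theorem basis_constant :
  exists2 M : R, 0 <= M & forall x n, `|partial_sum n x| <= M * `|x|.
Proof.
have [c c0 approx] := partial_sum_approx.
exists (2 * c) => [|x]; first by rewrite mulr_ge0.
have [->|x0] := eqVneq x 0.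
  by move=> n; rewrite partial_sum0 normr0 mulr0.
have nx : 0 < `|x| by rewrite normr_gt0.
have /choice[g gP] : forall yd : X * {d : R | 0 < d}, exists a,
    partial_sum_le (c * `|yd.1|) a /\ `|yd.1 - a| <= sval yd.2.
  by move=> [y [d d0]]; have [a] := approx y d d0; exists a.
have dj_gt0 j : 0 < `|x| / 2 ^+ j by rewrite divr_gt0// exprn_gt0.
pose d j : {d : R | 0 < d} := exist _ (`|x| / 2 ^+ j) (dj_gt0 j).
(* The remainders left by the successive approximations. *)
pose y := fix y j := if j is j'.+1 then y j' - g (y j', d j) else x.
pose a j := g (y j, d j.+1).
have yle j : `|y j| <= `|x| / 2 ^+ j.
  case: j => [|j]; first by rewrite expr0 divr1.
  by have [] := gP (y j, d j.+1).
pose D := c * `|x|.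
have D0 : 0 <= D by rewrite mulr_ge0// ltW.
have ale j : partial_sum_le (D / 2 ^+ j) (a j).
  move=> n; have [/(_ n) H _] := gP (y j, d j.+1); apply: le_trans H _.
  by rewrite /D -mulrA ler_wpM2l//=.
have yE J : y J = x - series a J.
  elim: J => [|J IH]; first by rewrite seriesEord/= big_ord0 subr0.
  by rewrite seriesSr opprD addrA -IH.
pose alpha i := limn (series (fun j => coord (a j) i) : nat -> R).
have coord_series J i :
    coord (series a J) i = series (fun j => coord (a j) i) J.
  elim: J => [|J IH]; first by rewrite !seriesEord/= !big_ord0 coord0.
  by rewrite !seriesSr addrC -[a J]scale1r coordP mul1r scale1r IH addrC.
have alpha_cvg i : (fun J => coord (series a J) i) @ \oo --> alpha i.
  under eq_fun do rewrite coord_series.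
  suff H : cvgn (series (fun j => coord (a j) i)) by exact: H.
  apply: (@series_halving _ _ (`|e i|^-1 * (D + D))) => j.
  apply: le_trans (coord_le i (ale j)) _.
  by rewrite -mulrDl mulrA.
have partial_cvg n :
    (fun J => partial_sum n (series a J)) @ \oo --> lincomb n alpha.
  apply: cvg_big => [|i _]; first exact: add_continuous.
  exact: cvgZr_tmp.
have tail J m n :
    `|partial_sum n (series a (J + m)%N) - partial_sum n (series a J)| <=
    2 * D / 2 ^+ J - 2 * D / 2 ^+ (J + m)%N.
  elim: m => [|m IH]; first by rewrite addn0 !subrr normr0.
  rewrite addnS seriesSr partial_sumD addrAC.
  apply: le_trans (ler_normD _ _) _; apply: le_trans (lerD IH (ale _ _)) _.
  rewrite le_eqVlt; apply/orP; left; apply/eqP; rewrite exprS; field.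
  by rewrite !expf_neq0.
have lim_tail J n :
    `|lincomb n alpha - partial_sum n (series a J)| <= 2 * D / 2 ^+ J.
  apply: cvgn_norm_sub (@partial_cvg n) _; near=> J'.
  have JJ' : (J <= J')%N by near: J'; exact: nbhs_infty_ge.
  rewrite -(subnKC JJ'); apply: le_trans (tail _ _ _) _.
  by rewrite gerBl divr_ge0// ?mulr_ge0// exprn_ge0.
have xalpha : coord x = alpha.
  apply: coord_unique; apply/cvgrPdist_le => eps eps0.
  have e30 : 0 < eps / 3 by rewrite divr_gt0.
  have [J1 HJ1] := exists_halving (2 * D) e30.
  have [J2 HJ2] := exists_halving `|x| e30.
  pose J := maxn J1 J2.
  have HJ (b : R) J' : 0 <= b -> (J' <= J)%N ->
      b / 2 ^+ J' <= eps / 3 -> b / 2 ^+ J <= eps / 3.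
    move=> b0 JJ' /(le_trans _); apply; apply: ler_wpM2l => //.
    by rewrite lef_pV2 ?posrE ?exprn_gt0// ler_weXn2l// ler1n.
  have E1 := HJ _ J1 (mulr_ge0 (ler0n _ 2) D0) (leq_maxl _ _) HJ1.
  have E2 := HJ _ J2 (ltW nx) (leq_maxr _ _) HJ2.
  have /cvgrPdist_le/(_ _ e30) := @coord_cvg (series a J).
  apply: filterS => n Hn.
  have -> : x - lincomb n alpha =
      y J + ((series a J - partial_sum n (series a J))
      - (lincomb n alpha - partial_sum n (series a J))).
    by rewrite opprB (addrA (_ - partial_sum n _)) subrK yE addrA subrK.
  have -> : eps = eps / 3 + (eps / 3 + eps / 3) by field.
  apply: le_trans (ler_normD _ _) _; apply: lerD.
    exact: le_trans (yle J) _.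
  apply: le_trans (ler_normB _ _) _; apply: lerD => //.
  exact: le_trans (lim_tail J n) _.
move=> n; have := lim_tail 0%N n.
rewrite seriesEord/= big_ord0 partial_sum0 subr0 expr0 divr1.
by rewrite /partial_sum xalpha mulrA.
Unshelve. all: by end_near. Qed.

End Basis.

(** * Block bases *)

Section BlockTrees.
Context {R : realType} {X : completeNormedModType R} (e : nat -> X).
Hypothesis basis_e : schauder_basis e.
Notation coord := (coord basis_e).
Notation partial_sum := (partial_sum basis_e).
Notation lincomb := (lincomb e).
Implicit Types (x z : X) (s t u : seq X) (us : seq (seq X)).

Definition supported (n N : nat) x :=
  forall i, coord x i != 0 -> (n <= i < N)%N.

Lemma supported_lincomb n N x : supported n N x -> x = lincomb N (coord x).
Proof.
move=> xN; have xx := @coord_cvg _ _ _ basis_e x.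
apply: (cvg_unique _ xx) => //; apply: cvg_near_cst; near=> m.
have Nm : (N <= m)%N by near: m; exact: nbhs_infty_ge.
rewrite -(subnKC Nm) lincomb_cat big1 ?addr0// => j _.
have [->|/xN] := eqVneq (coord x (N + j)%N) 0; first by rewrite scale0r.
by rewrite ltnNge leq_addr andbF.
Unshelve. all: by end_near. Qed.

Lemma coord_eq0 x : (forall i, coord x i = 0) -> x = 0.
Proof.
move=> x0; rewrite (@supported_lincomb 0 0 x); last first.
  by move=> i; rewrite x0 eqxx.
by rewrite /lincomb big_ord0.
Qed.

(** The coefficients in [block_basis] are determined by the vectors, so they can
    be replaced by coordinates; see [block_basisP]. *)
Definition block_support (n N : nat) s : Prop :=
  (forall j, (j < size s)%N -> s`_j != 0 /\ supported n N s`_j) /\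
  (forall j k, (j < k < size s)%N -> forall i l,
     coord s`_j i != 0 -> coord s`_k l != 0 -> (i < l)%N).

Lemma block_basisP s : block_basis e s <-> exists N, block_support 0 N s.
Proof.
split=> -[N].
  move=> [a [sa al]]; exists N.
  have cs j : (j < size s)%N ->
      coord s`_j =1 fun i => if (i < N)%N then a j i else 0.
    by move=> /sa[_ ->] i; exact: coord_lincomb.
  split=> [j js|j k jks i l].
    split=> [|i]; first by have [] := sa j js.
    by rewrite cs//=; case: ifP; rewrite ?eqxx.
  have /andP[jk ks] := jks; rewrite !cs ?(ltn_trans jk)//.
  case: ifP => [iN|]; rewrite ?eqxx//; case: ifP => [lN|]; rewrite ?eqxx//.
  exact: (al j k jks (Ordinal iN) (Ordinal lN)).
move=> [sN sl]; exists N, (fun j => coord s`_j); split.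
  by move=> j /sN[? /supported_lincomb].
by move=> j k jk i l; exact: sl.
Qed.

(** The recursion runs along the construction of block sequences below, where
    each vector is chosen beyond the bound m left by its predecessor. *)
Fixpoint blocks (n N : nat) s : Prop :=
  if s is x :: s' then exists m, [/\ x != 0, supported n m x & blocks m N s']
  else (n <= N)%N.

Lemma supported_neq0 n N x : x != 0 -> supported n N x ->
  exists2 i, coord x i != 0 & (n <= i < N)%N.
Proof.
move=> x0 xN; have /existsNP[i /eqP xi] : ~ forall i, coord x i = 0.
  by move=> /coord_eq0 /eqP; exact/negP.
by exists i => //; exact: xN.
Qed.

Lemma blocks_le n N s : blocks n N s -> (n <= N)%N.
Proof.
elim: s n => //= x s IH n [m [x0 xm /IH mN]].
by have [i _ /andP[ni im]] := supported_neq0 x0 xm; lia.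
Qed.

Lemma supported_le n N n' N' x : (n' <= n)%N -> (N <= N')%N ->
  supported n N x -> supported n' N' x.
Proof. by move=> nn NN xN i /xN; lia. Qed.

Lemma blocks_supported n N s : blocks n N s -> block_support n N s.
Proof.
elim: s n => [|x s IH] n /=; first by split=> // j k; rewrite ltn0 andbF.
move=> [m [x0 xm sN]]; have [sP sl] := IH m sN.
have nm : (n <= m)%N by have [i _] := supported_neq0 x0 xm; lia.
split=> [[_|j /= /sP[sj]]|[|j] [//|k] /= jk i l].
- by split=> //; exact: supported_le (leqnn _) (blocks_le sN) xm.
- by move=> ?; split=> //; apply: (@supported_le m N).
- have [_ sk] := sP k jk; move=> /xm + /sk; lia.
- exact: sl.
Qed.

Lemma blocks_block_basis n N s : blocks n N s -> block_basis e s.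
Proof.
move=> /blocks_supported[sN sl]; apply/block_basisP; exists N.
split=> // j /sN[? ?].
by split=> //; apply: (@supported_le n N).
Qed.

Lemma coord_sum m (a : nat -> R) (u : nat -> X) i :
  coord (\sum_(0 <= j < m) a j *: u j) i =
  \sum_(0 <= j < m) a j * coord (u j) i.
Proof.
elim: m => [|m IH]; first by rewrite !big_geq// coord0.
by rewrite !big_nat_recr//= addrC coordP IH addrC.
Qed.

(** The first n coordinates impose n linear conditions on more than n
    coefficients. *)
Lemma exists_annihilated n (u : seq X) : (n < size u)%N ->
  exists2 a : nat -> R, 0 < \sum_(0 <= j < size u) `|a j| &
    forall i, (i < n)%N -> coord (\sum_(0 <= j < size u) a j *: u`_j) i = 0.
Proof.
move=> nu; pose A : 'M[R]_(size u, n) := \matrix_(j, i) coord u`_j i.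
have : kermx A != 0.
  rewrite -mxrank_eq0 mxrank_ker -lt0n subn_gt0.
  exact: leq_ltn_trans (rank_leq_col A) _.
case/rowV0Pn => v /sub_kermxP vA v0.
pose a j := if insub j is Some k then v 0 k else 0.
have aE (j : 'I_(size u)) : a j = v 0 j by rewrite /a valK.
exists a => [|i ni].
  rewrite big_mkord lt_neqAle sumr_ge0 ?andbT// eq_sym.
  apply: contraNneq v0 => /eqP; rewrite psumr_eq0// => /allP a0.
  apply/eqP/rowP => j; rewrite mxE -aE.
  by apply/eqP; rewrite -normr_eq0; apply: a0; rewrite mem_index_enum.
have := congr1 (fun M : 'rV_n => M 0 (Ordinal ni)) vA; rewrite !mxE => vAi.
rewrite coord_sum big_mkord -[RHS]vAi; apply: eq_bigr => j _.
by rewrite aE !mxE.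
Qed.

(** * Blocking an l_1-tree *)

(** Here zN is a unit vector with a bound for its support.  Being only c / 2
    away from a combination of u of l_1-norm at least 1, it may replace that
    combination in lower l_1-estimates with constant c at the cost of a factor
    1 / 2. *)
Definition tail_approx (c : R) n u (zN : X * nat) : Prop :=
  [/\ `|zN.1| = 1, supported n zN.2 zN.1 & exists a : nat -> R,
    1 <= \sum_(0 <= i < size u) `|a i| /\
    `|zN.1 - \sum_(0 <= i < size u) a i *: u`_i| <= c / 2].

Lemma exists_tail_approx c n u : 0 < c -> lower_l1 c u ->
  (forall x, x \in u -> `|x| = 1) -> (n < size u)%N ->
  exists zN, tail_approx c n u zN.
Proof.
move=> c0 uc u1 /exists_annihilated[a a0 an].
set w := \sum_(0 <= j < size u) a j *: u`_j in an.
have w0 : 0 < `|w| by apply: lt_le_trans (uc a); exact: mulr_gt0.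
pose b i := `|w|^-1 * a i.
have bE : \sum_(0 <= j < size u) b j *: u`_j = `|w|^-1 *: w.
  by rewrite scaler_sumr; apply: eq_bigr => i _; rewrite scalerA.
set v := `|w|^-1 *: w in bE.
have v1 : `|v| = 1 by rewrite normrZ gtr0_norm ?invr_gt0// mulVf ?gt_eqF.
have b1 : 1 <= \sum_(0 <= i < size u) `|b i|.
  rewrite -v1 -bE; apply: le_trans (ler_norm_sum _ _ _) _.
  rewrite !big_mkord; apply: ler_sum => i _.
  by rewrite normrZ (u1 u`_i) ?mulr1// mem_nth.
have vn i : (i < n)%N -> coord v i = 0.
  by move=> /an wi; rewrite /v -[_ *: w]addr0 coordP wi coord0 mulr0 addr0.
(* Truncation and renormalization each cost c / 4; the bound 1 / 2 keeps the
   truncated vector away from 0. *)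
have d0 : 0 < Num.min (c / 4) (1 / 2) by rewrite lt_min !divr_gt0.
have /cvgrPdist_le/(_ _ d0)[N _ HN] := @coord_cvg _ _ _ basis_e v.
have := HN N (leqnn N); rewrite le_min => /andP[vNc vN2].
set p := lincomb N (coord v) in vNc vN2.
have p2 : 1 / 2 <= `|p|.
  have : `|v| <= `|v - p| + `|p| by rewrite -{1}[v](subrK p) ler_normD.
  rewrite v1; lra.
have p0 : 0 < `|p| by lra.
have pv : `|p - `|p|^-1 *: p| <= c / 4.
  apply: le_trans vNc; apply: le_trans (ler_dist_dist _ _).
  have -> : p - `|p|^-1 *: p = (1 - `|p|^-1) *: p by rewrite scalerBl scale1r.
  rewrite v1 distrC normrZ -{2}(gtr0_norm p0) -normrM.
  by rewrite mulrBl mul1r mulVf ?gt_eqF// [leRHS]distrC.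
exists (`|p|^-1 *: p, N); split=> /=.
- by rewrite normrZ gtr0_norm ?invr_gt0// mulVf ?gt_eqF.
- move=> i; rewrite -[_ *: p]addr0 coordP coord0 addr0 coord_lincomb.
  case: ifP => [iN|]; last by rewrite mulr0 eqxx.
  by rewrite andbT leqNgt; apply: contra => /vn ->; rewrite mulr0.
- exists b; split=> //; rewrite bE -(subrK p (_ *: p)) -addrA.
  apply: le_trans (ler_normD _ _) _.
  have -> : c / 2 = c / 4 + c / 4 by field.
  by apply: lerD => //; rewrite distrC.
Qed.

(** Trees of blocks with lower constant c.  Unlike [l1_block_tree] this admits
    the empty set, which arises from trees that are too short to be blocked. *)
Definition block_l1_set (c : R) (T : set (seq X)) : Prop :=
  [/\ countable T, forall s, T s -> s != [::],
      forall s, T s -> forall x, x \in s -> `|x| = 1,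
      forall s, T s -> lower_l1 c s & forall s, T s -> block_basis e s].

Section Blocking.
Variable c : R.
Hypothesis c_gt0 : 0 < c.

Definition tail_vector n u : X * nat := get (tail_approx c n u).

(** The list us is a node cut into segments; each segment contributes one
    vector, supported beyond the previous one. *)
Fixpoint blocked n us : seq X :=
  if us is u :: us' then
    (tail_vector n u).1 :: blocked (tail_vector n u).2 us' else [::].

Fixpoint blocked_end n us : nat :=
  if us is u :: us' then blocked_end (tail_vector n u).2 us' else n.

Fixpoint long_segments n us : Prop :=
  if us is u :: us' then (n < size u)%N /\ long_segments (tail_vector n u).2 us'
  else True.

Lemma blocked_rcons n us u : blocked n (rcons us u) =
  rcons (blocked n us) (tail_vector (blocked_end n us) u).1.
Proof. by elim: us n => //= v us IH n; rewrite IH. Qed.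

Lemma long_segments_rcons n us u : long_segments n us ->
  (blocked_end n us < size u)%N -> long_segments n (rcons us u).
Proof. by elim: us n => //= v us IH n [nv /IH H] /H. Qed.

(** The coefficients d are those of a linear combination of the blocked vectors
    rewritten in terms of the original ones. *)
Lemma blockedP n us : long_segments n us -> lower_l1 c (flatten us) ->
  (forall x, x \in flatten us -> `|x| = 1) ->
  [/\ blocks n (blocked_end n us) (blocked n us),
      forall x, x \in blocked n us -> `|x| = 1 &
      forall a : nat -> R, exists d : nat -> R,
       let l := \sum_(0 <= i < size (blocked n us)) `|a i| in
       l <= \sum_(0 <= i < size (flatten us)) `|d i| /\
       `|\sum_(0 <= i < size (blocked n us)) a i *: (blocked n us)`_i -
         \sum_(0 <= i < size (flatten us)) d i *: (flatten us)`_i| <=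
           c / 2 * l].
Proof.
elim: us n => [|u us IH] n /=.
  move=> _ _ _; split=> // a; exists (fun=> 0).
  by rewrite !big_geq// subrr normr0 mulr0.
move=> [nu longs] uc u1.
have [] : tail_approx c n u (tail_vector n u).
  apply: getPex; apply: exists_tail_approx => //; first exact: lower_l1_catl uc.
  by move=> x xu; apply: u1; rewrite mem_cat xu.
case: (tail_vector n u) longs => z N /= longs z1 zN [b [b1 bz]].
have [|x xus|zs zs1 zsc] := IH N longs; first exact: lower_l1_catr uc.
  by apply: u1; rewrite mem_cat xus orbT.
split=> [|x|a].
- by exists N; split=> //; rewrite -normr_gt0 z1.
- by rewrite inE => /predU1P[->//|]; exact: zs1.
have [d [dl dz]] := zsc (fun i => a i.+1).
have [f [fl fz]] := coef_cat u (flatten us) (fun i => a 0%N * b i) d.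
exists f; rewrite fl fz !big_nat_recl//=.
under [in X in _ /\ `|_ - (X + _)| <= _]eq_bigr => i _ do rewrite -scalerA.
under [in X in _ <= X + _ /\ _]eq_bigr => i _ do rewrite normrM.
rewrite -mulr_sumr -scaler_sumr; split.
  by apply: lerD => //; rewrite ler_peMr.
rewrite opprD addrACA -scalerBr mulrDr; apply: le_trans (ler_normD _ _) _.
by apply: lerD => //; rewrite normrZ mulrC ler_wpM2r.
Qed.

Lemma blocked_lower n us : long_segments n us -> lower_l1 c (flatten us) ->
  (forall x, x \in flatten us -> `|x| = 1) -> lower_l1 (c / 2) (blocked n us).
Proof.
move=> longs uc u1 a; have [_ _ /(_ a)[d [dl dz]]] := blockedP longs uc u1.
have := uc d.
set l := \sum_(_ <= _ < _) _ in dl dz *; set z := \sum_(_ <= _ < _) _ in dz *.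
set w := \sum_(_ <= _ < _) d _ *: _ in dz *.
set dd := \sum_(_ <= _ < _) _ in dl *.
move=> cw; have : `|w| <= `|z| + `|z - w|.
  by rewrite -{1}(subKr z w); exact: ler_normB.
have : c * l <= c * dd by rewrite ler_pM2l.
have : c / 2 * l = c * l / 2 by rewrite mulrAC.
lra.
Qed.

Definition prefix_closure (T : set (seq X)) : set (seq X) :=
  [set s | exists2 t, T t & prefix s t].

(** All segmentations of all initial parts of nodes are admitted; this keeps the
    tree countable without losing rank. *)
Definition blocked_tree (T : set (seq X)) : set (seq X) :=
  blocked 0 @` [set us | [/\ us != [::], long_segments 0 us &
    prefix_closure T (flatten us)]].

Lemma countable_prefix_closure T : countable T -> countable (prefix_closure T).
Proof.
move=> cT; apply: (@sub_countable _ _ _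
  ((fun tn => take tn.2 tn.1) @` (T `*` [set: nat]))).
  apply: subset_card_le => s [t Tt /prefixP[u tE]].
  by exists (t, size s) => //=; rewrite tE take_size_cat.
by apply: sub_countable (card_image_le _ _) _; exact: countableX.
Qed.

Lemma countable_blocked_tree T : countable T -> countable (blocked_tree T).
Proof.
move=> cT; apply: sub_countable (card_image_le _ _) _.
apply: (@sub_countable _ _ _ ((fun sn => reshape sn.2 sn.1) @`
  (prefix_closure T `*` [set: seq nat]))).
  apply: subset_card_le => us [_ _ pT].
  by exists (flatten us, shape us) => //=; rewrite flattenK.
apply: sub_countable (card_image_le _ _) _; apply: countableX => //.
exact: countable_prefix_closure.
Qed.

Lemma blocked_treeP T : countable T ->
  (forall s, T s -> forall x, x \in s -> `|x| = 1) ->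
  (forall s, T s -> lower_l1 c s) -> block_l1_set (c / 2) (blocked_tree T).
Proof.
move=> cT T1 Tc.
have pc s : prefix_closure T s -> lower_l1 c s.
  by move=> [t /Tc + /prefixP[u tE]]; rewrite tE; exact: lower_l1_catl.
have p1 s : prefix_closure T s -> forall x, x \in s -> `|x| = 1.
  by move=> [t /T1 t1 /prefixP[u tE]] x xs; apply: t1; rewrite tE mem_cat xs.
split; first exact: countable_blocked_tree.
- by move=> _ [[|u us] [us0 _ _] <-].
- move=> _ [us [_ longs pT] <-].
  by have [] := blockedP longs (pc _ pT) (p1 _ pT).
- move=> _ [us [_ longs pT] <-].
  exact: blocked_lower longs (pc _ pT) (p1 _ pT).
- move=> _ [us [_ longs pT] <-].
  by have [/blocks_block_basis] := blockedP longs (pc _ pT) (p1 _ pT).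
Qed.

(** A node of rank omega * b + omega has extensions of rank omega * b by as many
    vectors as desired, in particular by a segment long enough for the next
    block. *)
Lemma blocked_tree_rank T b : has_rank T (omul omega b) [::] ->
  has_rank (blocked_tree T) b [::].
Proof.
move=> /(@has_rank_subset _ _ (prefix_closure T)) H.
have {}H : has_rank (prefix_closure T) (omul omega b) (flatten [::]).
  by apply: H => s Ts; exists s => //; exact: prefix_refl.
suff : forall us, long_segments 0 us ->
  has_rank (prefix_closure T) (omul omega b) (flatten us) ->
  has_rank (blocked_tree T) b (blocked 0 us) by move=> /(_ [::]); apply.
elim: b {H} => // [b IH|B g IH] us longs; last by move=> H i; exact: IH (H i).
move=> H; have /has_rank_oadd[u [ku Tu ub]] :
    has_rank (prefix_closure T)
      (oadd (omul omega b) (ofin (blocked_end 0 us).+1)) (flatten us).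
  exact: (H false (blocked_end 0 us).+1).
have longs' : long_segments 0 (rcons us u) by exact: long_segments_rcons.
have flatE : flatten us ++ u = flatten (rcons us u).
  by rewrite flatten_rcons.
exists (blocked 0 (rcons us u)); split.
- exists (rcons us u) => //; split=> //; first by case: (us).
  by rewrite -flatE; case: Tu => // u0; rewrite u0 in ku.
- apply/extendsP; exists [:: (tail_vector (blocked_end 0 us) u).1].
  by rewrite cats1 blocked_rcons.
- by apply: IH longs' _; rewrite -flatE.
Qed.

End Blocking.

Lemma l1_tree_block_tree (K : R) (T : set (seq X)) b : 0 < K -> l1_tree K T ->
  has_rank T (omul omega b) [::] ->
  exists (c : R) (T' : set (seq X)),
    [/\ 0 < c, block_l1_set c T' & has_rank T' b [::]].
Proof.
move=> K0 TK Tb; have [[cT _ _] T1 _] := TK.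
exists (K^-1 / 2), (blocked_tree K^-1 T); split.
- by rewrite divr_gt0// invr_gt0.
- apply: blocked_treeP => //; first by rewrite invr_gt0.
  by move=> s Ts; exact: l1_tree_lower TK Ts.
- exact: blocked_tree_rank.
Qed.

(** * Doubling a block tree *)

Definition support_bound s : nat := get (block_support 0 ^~ s).

(** In a block sequence the j-th vector is supported in [j, oo), so dropping the
    first [support_bound s] vectors of u leaves blocks beyond s.  Empty s and u
    are admitted so that T and the tails hung below the root are included. *)
Definition concat_tree (T : set (seq X)) : set (seq X) :=
  [set v | v != [::] /\ exists s u, [/\ s = [::] \/ T s, u = [::] \/ T u &
     v = s ++ drop (support_bound s) u]].

Lemma block_basis_supported N s :
  block_support 0 N s ->
  forall j, (j < size s)%N -> supported j N s`_j.
Proof.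
move=> [sN sl]; elim=> [|j IH] js i si; first by have [_] := sN _ js; exact.
have js' := ltnW js.
have [sj0 sjN] := sN j js'.
have [l sjl /andP[jl _]] := supported_neq0 sj0 (IH js').
have [_ /(_ i si)/andP[_ ->]] := sN _ js; rewrite andbT.
apply: leq_ltn_trans jl _; apply: sl sjl si; by rewrite ltnSn.
Qed.

Lemma block_basis_nil : block_basis e ([::] : seq X).
Proof. by exists 0%N, (fun _ _ => 0); split=> // j k; rewrite ltn0 andbF. Qed.

Lemma support_boundP s : block_basis e s ->
  block_support 0 (support_bound s) s.
Proof. by move=> /block_basisP sP; apply: (getPex sP). Qed.

Lemma drop_supported N s : block_basis e s ->
  forall j, (j < size (drop N s))%N ->
  supported N (support_bound s) (drop N s)`_j.
Proof.
move=> /support_boundP[sN sl] j; rewrite size_drop nth_drop => jN.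
have js : (N + j < size s)%N by lia.
apply: supported_le (block_basis_supported (conj sN sl) js) => //.
exact: leq_addr.
Qed.

Lemma block_basis_concat s u : block_basis e s -> block_basis e u ->
  block_basis e (s ++ drop (support_bound s) u).
Proof.
move=> bs bu; have [sN sl] := support_boundP bs.
have [uN ul] := support_boundP bu.
set N := support_bound s in sN *; have dN := @drop_supported N u bu.
apply/block_basisP; exists (maxn N (support_bound u)); split=> [j|j k].
- rewrite size_cat nth_cat => jt; case: (ltnP j (size s)) => [js|sj].
    have [? H] := sN j js; split=> //.
    exact: supported_le (leqnn 0) (leq_maxl _ _) H.
  have jd : (j - size s < size (drop N u))%N by lia.
  split; last exact: supported_le (leq0n _) (leq_maxr _ _) (dN _ jd).
  have ju : (N + (j - size s) < size u)%N by move: jd; rewrite size_drop; lia.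
  by rewrite nth_drop; have [] := uN _ ju.
- rewrite size_cat !nth_cat => /andP[jk kt] i l.
  have [js|sj] := ltnP j (size s); have [ks|sk] := ltnP k (size s).
  + by apply: sl; rewrite jk.
  + have [_ H] := sN j js; move=> /H /andP[_ iN].
    have kd : (k - size s < size (drop N u))%N by lia.
    by move=> /(dN _ kd)/andP[Nl _]; exact: leq_trans iN Nl.
  + lia.
  + rewrite !nth_drop; apply: ul.
    have : (k - size s < size (drop N u))%N by lia.
    rewrite size_drop => H; apply/andP; split; last by rewrite -ltn_subRL.
    by rewrite ltn_add2l ltn_sub2r//; exact: leq_ltn_trans jk.
Qed.

Lemma partial_sum_supported n x : supported 0 n x -> partial_sum n x = x.
Proof. by move=> /supported_lincomb xE; rewrite [RHS]xE. Qed.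

Lemma partial_sum_vanish n x :
  (forall i, (i < n)%N -> coord x i = 0) -> partial_sum n x = 0.
Proof.
by move=> x0; rewrite /partial_sum /lincomb big1// => i _; rewrite x0// scale0r.
Qed.

(** With x in the span of s and y in that of t, the projection onto the first N
    coordinates sends x + y to x, so |x| + |y| <= (2 M + 1) |x + y|. *)
Lemma lower_l1_concat (c M : R) N s t : 0 < c -> 0 <= M ->
  (forall x n, `|partial_sum n x| <= M * `|x|) ->
  (forall j, (j < size s)%N -> supported 0 N s`_j) ->
  (forall j i, (j < size t)%N -> (i < N)%N -> coord t`_j i = 0) ->
  lower_l1 c s -> lower_l1 c t -> lower_l1 (c / (2 * M + 1)) (s ++ t).
Proof.
move=> c0 M0 PM sN tN sc tc; apply/lower_l1_cat => a b.
set x := \sum_(_ <= i < _) a i *: _; set y := \sum_(_ <= i < _) b i *: _.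
have Px : partial_sum N x = x.
  apply: partial_sum_supported => i xi /=.
  rewrite ltnNge; apply: contra_neqN xi => Ni.
  rewrite coord_sum big_nat big1// => j /andP[_ js].
  have [->|/(sN j js)] := eqVneq (coord s`_j i) 0; first by rewrite mulr0.
  by rewrite ltnNge Ni andbF.
have Py : partial_sum N y = 0.
  apply: partial_sum_vanish => i iN.
  by rewrite coord_sum big_nat big1// => j /andP[_ jt]; rewrite tN// mulr0.
have xM : `|x| <= M * `|x + y|.
  by rewrite -{1}Px -[partial_sum N x]addr0 -Py -partial_sumD.
have yM : `|y| <= `|x + y| + `|x|.
  by rewrite -{1}(addKr x y) addrC; exact: ler_normB.
rewrite mulrAC ler_pdivrMr; last lra.
have := sc a; have := tc b; rewrite -/x -/y; lra.
Qed.

Lemma concat_tree_block (c M : R) T : 0 < c -> 0 <= M ->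
  (forall x n, `|partial_sum n x| <= M * `|x|) ->
  block_l1_set c T -> block_l1_set (c / (2 * M + 1)) (concat_tree T).
Proof.
move=> c0 M0 PM [cT T0 T1 Tc Tb].
have lower_nil : lower_l1 c ([::] : seq X).
  by move=> a; rewrite !big_geq// mulr0.
have Tc' s : s = [::] \/ T s -> lower_l1 c s by case=> [->|/Tc].
have Tb' s : s = [::] \/ T s -> block_basis e s.
  by case=> [->|/Tb//]; exact: block_basis_nil.
have T1' s : s = [::] \/ T s -> forall x, x \in s -> `|x| = 1.
  by case=> [->|/T1].
split.
- have cT' : countable ([set [::]] `|` T).
    by rewrite -bigcup2E; apply: bigcup_countable => // -[|[|i]] _ /=;
      [exact: countable1| |exact: countable0].
  apply: (@sub_countable _ _ _
    ((fun su => su.1 ++ drop (support_bound su.1) su.2) @`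
      (([set [::]] `|` T) `*` ([set [::]] `|` T)))).
    by apply: subset_card_le => v [_ [s [u [sT uT ->]]]]; exists (s, u).
  by apply: sub_countable (card_image_le _ _) _; exact: countableX.
- by move=> v [].
- move=> _ [_ [s [u [sT uT ->]]]] x.
  rewrite mem_cat => /orP[|/mem_drop]; exact: T1'.
- move=> _ [_ [s [u [sT uT ->]]]].
  have [sN _] := support_boundP (Tb' s sT).
  apply: (lower_l1_concat (N := support_bound s)) => //.
  + by move=> j /sN[].
  + move=> j i jd iN; apply/eqP; apply: contraTT iN => ji.
    have /(_ _ ji)/andP[Ni _] := drop_supported (Tb' u uT) jd.
    by rewrite -leqNgt.
  + exact: Tc'.
  + apply: (@lower_l1_catr _ _ _ (take (support_bound s) u)).
    by rewrite cat_take_drop; exact: Tc'.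
- move=> _ [_ [s [u [sT uT ->]]]].
  exact: block_basis_concat (Tb' s sT) (Tb' u uT).
Qed.

Lemma concat_tree_tail T a s u :
  s = [::] \/ T s -> (support_bound s <= size u)%N ->
  has_rank T a u -> has_rank (concat_tree T) a (s ++ drop (support_bound s) u).
Proof.
move=> sT; elim: a u => //= [a IH u su|A f IH u su H i]; last exact: IH.
move=> [t [Tt /extendsP[v [v0 tE]] ta]].
have tdE : drop (support_bound s) t = drop (support_bound s) u ++ v.
  rewrite tE drop_cat ltn_neqAle su andbT; case: eqVneq => [->|//].
  by rewrite subnn drop0 drop_size.
exists (s ++ drop (support_bound s) t); split.
- split; last by exists s, t; split=> //; right.
  by rewrite tdE -!size_eq0 !size_cat !addn_eq0 !size_eq0 (negbTE v0) !andbF.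
- by apply/extendsP; exists v; rewrite -catA -tdE.
- by apply: IH => //; rewrite tE size_cat (leq_trans su)// leq_addr.
Qed.

(** For x < omega * d also x + N + 1 <= omega * d, as omega * d is a limit; so T
    has a node with at least N vectors whose rank exceeds x, and its tail beyond
    N continues s. *)
Lemma concat_tree_rank_top T d s : s = [::] \/ T s ->
  has_rank T (omul omega d) [::] -> has_rank (concat_tree T) (omul omega d) s.
Proof.
move=> sT Td; apply: has_rank_limit => x xd.
have xNd k : olt (oadd (osucc x) (ofin k)) (omul omega d).
  by elim: k => [|k]; exact: olt_succ_omul_omega.
have /has_rank_oadd[u [Nu _ ux]] :=
  has_rank_le (olt_le (xNd (support_bound s))) Td.
apply: has_rank_prefix (concat_tree_tail sT Nu ux); exact: prefix_prefix.
Qed.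

Lemma concat_tree_rank T d (x : ord) s : s = [::] \/ T s ->
  has_rank T (omul omega d) [::] -> has_rank T x s ->
  has_rank (concat_tree T) (oadd (omul omega d) x) s.
Proof.
move=> sT Td; elim: x s sT => [|x IH|A f IH] s sT /=.
- by move=> _; exact: concat_tree_rank_top.
- move=> [t [Tt st tx]]; exists t; split=> //; last by apply: IH => //; right.
  split; last by exists t, [::]; split; [right|left|rewrite cats0].
  have /extendsP[v [v0 ->]] := st.
  by rewrite -size_eq0 size_cat addn_eq0 !size_eq0 (negbTE v0) andbF.
- by move=> H [|i]; [exact: concat_tree_rank_top|exact: IH].
Qed.

Lemma block_tree_double (c : R) (T : set (seq X)) d :
  0 < c -> block_l1_set c T -> has_rank T (omul omega d) [::] ->
  exists (c' : R) (T' : set (seq X)), [/\ 0 < c', block_l1_set c' T' &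
    has_rank T' (oadd (omul omega d) (omul omega d)) [::]].
Proof.
move=> c0 Tc Td; have [M M0 PM] := basis_constant basis_e.
exists (c / (2 * M + 1)), (concat_tree T); split.
- by rewrite divr_gt0//; lra.
- exact: concat_tree_block.
- by apply: concat_tree_rank => //; left.
Qed.

(** * Comparison of the indices *)

Hypothesis no_l1 : ~ contains_l1 X.

Lemma olt_l1_index b : olt b (l1_index X) ->
  exists (K : R) (T : set (seq X)),
    [/\ 1 <= K, l1_tree K T & has_rank T (osucc b) [::]].
Proof.
move=> [[K K1] [[T TK] bT]]; exists K, T; split=> //.
have [[_ _ T0] _ _] := TK.
have [a Ta] := l1_tree_well_founded no_l1 (lt_le_trans ltr01 K1) TK.
exact/(le_tree_order _ T0 Ta).
Qed.

Lemma olt_block_l1_index b : olt b (block_l1_index e) ->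
  exists (c : R) (T : set (seq X)),
    [/\ 0 < c, block_l1_set c T & has_rank T (osucc b) [::]].
Proof.
move=> [[K K1] [[T [TK Tb]] bT]]; have [[cT _ T0] T1 _] := TK.
have K0 := lt_le_trans ltr01 K1.
exists K^-1, T; split=> //; first by rewrite invr_gt0.
  by split=> // s Ts; exact: l1_tree_lower TK Ts.
have [a Ta] := l1_tree_well_founded no_l1 K0 TK.
exact/(le_tree_order _ T0 Ta).
Qed.

Lemma block_l1_index_ge (c : R) (T : set (seq X)) b :
  0 < c -> block_l1_set c T -> has_rank T b [::] -> ord_le b (block_l1_index e).
Proof.
move=> c0 [cT T0 T1 Tc Tb] bT.
have [TE|TN] := eqVneq T set0.
  apply: (@ord_le_trans ozero) => //; rewrite TE in bT.
  exact: has_rank_set0 bT.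
have cK : c^-1 <= Num.max 1 c^-1 by rewrite le_max lexx orbT.
have TK : l1_tree (Num.max 1 c^-1) T.
  by apply: (@lower_l1_tree _ _ _ c) => //; exact/set0P.
have K1 : 1 <= Num.max 1 c^-1 by rewrite le_max lexx.
have [a Ta] := l1_tree_well_founded no_l1 (lt_le_trans ltr01 K1) TK.
rewrite /block_l1_index.
apply: (@le_osup _ _ (exist _ (Num.max 1 c^-1) K1)).
rewrite /block_l1_index_const /=.
apply: (@le_osup _ _ (exist _ T (conj TK Tb))).
exact/(le_tree_order _ T0 Ta).
Qed.

Lemma block_l1_index_le : ord_le (block_l1_index e) (l1_index X).
Proof.
move=> K; apply: (@le_osup _ _ K) => -[T [TK Tb]].
apply: (@le_osup _ _ (exist _ T TK)); exact: ord_le_refl.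
Qed.

Lemma l1_index_le_block : ord_le (omega_pow omega) (l1_index X) ->
  ord_le (l1_index X) (block_l1_index e).
Proof.
move=> large; set B := block_l1_index e.
have reach (K : R) (T : set (seq X)) b : 1 <= K -> l1_tree K T ->
    has_rank T (omul omega b) [::] -> ord_le b B.
  move=> K1 TK Tb.
  have [c [T' [c0 T'c T'b]]] :=
    l1_tree_block_tree (lt_le_trans ltr01 K1) TK Tb.
  exact: block_l1_index_ge c0 T'c T'b.
have powB n : ord_le (omega_fpow n) B.
  have [|K [T [K1 TK Tn]]] := @olt_l1_index (omega_fpow n.+1).
    apply: ord_le_trans (olt_omega_pow n.+1) _; apply: ord_le_trans large.
    exact: omega_pow_le_omega_pow_omega.
  apply: reach K1 TK _; apply: has_rank_le Tn.
  exact: ord_le_trans (omul_omega_pow n) (ord_le_succ _).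
have dbl (c : R) (T : set (seq X)) d : 0 < c -> block_l1_set c T ->
    ord_le (omul omega d) d -> has_rank T d [::] -> ord_le (oadd d d) B.
  move=> c0 Tc dd /(has_rank_le dd) Td.
  have [c' [T' [c'0 T'c T'd]]] := block_tree_double c0 Tc Td.
  apply: block_l1_index_ge c'0 T'c _; apply: has_rank_le T'd.
  by apply: oadd_mono; exact: le_omul_omega.
have BB : ord_le (omul omega B) B.
  apply: omul_omega_absorb => // d dd /olt_block_l1_index[c [T [c0 Tc Td]]].
  exact: dbl c0 Tc dd (has_rank_le (ord_le_succ _) Td).
have [//|/olt_l1_index[K [T [K1 TK TB]]]] := ord_le_total (l1_index X) B.
have {}TB : has_rank T (omul omega B) [::].
  exact: has_rank_le (ord_le_trans BB (ord_le_succ _)) TB.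
have [c [T' [c0 T'c T'B]]] := l1_tree_block_tree (lt_le_trans ltr01 K1) TK TB.
have := dbl _ _ _ c0 T'c BB T'B.
have B0 : olt ozero B := ord_le_trans (omega_pow_gt0 0) (powB 0%N).
by move=> /(ord_le_trans (olt_oadd (ord_le_refl B) B0)) /ord_lt_irrefl.
Qed.

End BlockTrees.

Theorem corollary5p13 (R : realType) (X : completeNormedModType R)
    (e : nat -> X)
    (no_l1 : ~ contains_l1 X)
    (basis_e : schauder_basis e)
    (large_index : ord_le (omega_pow omega) (l1_index X)) :
  ord_eq (l1_index X) (block_l1_index e).
Proof.
split; last exact: block_l1_index_le.
exact: l1_index_le_block.
Qed.
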